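(* (i) Any finite $5$-CH graph with girth $4$ is CH. (ii) There are infinitely many (pairwise non-isomorphic) finite connected $4$-CH graphs with girth $4$ that are not $5$-CH.
   Context: All graphs are undirected and simple with non-empty vertex set. The girth is the length of a shortest cycle. For a positive integer $k$, a graph $\Gamma$ is $k$-CH if any isomorphism between connected induced subgraphs of $\Gamma$ of order at most $k$ extends to an automorphism of $\Gamma$; it is CH if it is $k$-CH for all $k$. *)

(* Defs.v *)
From mathcomp Require Import all_boot.

Set Implicit Arguments.
Unset Strict Implicit.
Unset Printing Implicit Defensive.

Record sgraph := SGraph {
  vertex :> finType;
  adj : rel vertex;
  adj_sym : symmetric adj;
  adj_irr : irreflexive adj;
  vertex_gt0 : 0 < #|vertex|
}.

Section Induced.
Variables (G : sgraph) (A : {set G}) (A_n0 : A != set0).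

Definition induced_adj : rel {x : G | x \in A} :=
  fun x y => adj (val x) (val y).

Lemma induced_adj_sym : symmetric induced_adj.
Proof. by move=> x y; apply: adj_sym. Qed.

Lemma induced_adj_irr : irreflexive induced_adj.
Proof. by move=> x; apply: adj_irr. Qed.

Lemma induced_gt0 : 0 < #|{: {x : G | x \in A}}|.
Proof. by rewrite card_sig card_gt0. Qed.

Definition induced : sgraph :=
  SGraph induced_adj_sym induced_adj_irr induced_gt0.

End Induced.

Definition connected (G : sgraph) : Prop := forall x y : G, connect (@adj G) x y.

Definition is_isom (G H : sgraph) (f : G -> H) : Prop :=
  bijective f /\ forall x y : G, adj (f x) (f y) = adj x y.

Definition isomorphic (G H : sgraph) : Prop := exists f : G -> H, is_isom f.

(* The bound 2 < size c is needed: a single edge is a ucycle of size 2. *)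
Definition is_graph_cycle (G : sgraph) (c : seq G) : Prop :=
  2 < size c /\ ucycle (@adj G) c.

(* Relational, so that acyclic graphs have no girth in nat. *)
Definition has_girth (G : sgraph) (g : nat) : Prop :=
  (exists2 c : seq G, is_graph_cycle c & size c = g) /\
  (forall c : seq G, is_graph_cycle c -> g <= size c).

Definition k_CH (k : nat) (G : sgraph) : Prop :=
  forall (A B : {set G}) (A_n0 : A != set0) (B_n0 : B != set0)
         (f : induced A_n0 -> induced B_n0),
    connected (induced A_n0) -> connected (induced B_n0) ->
    #|A| <= k -> #|B| <= k -> is_isom f ->
    exists2 g : G -> G, is_isom g &
      forall x : induced A_n0, g (val x) = val (f x).

Definition CH (G : sgraph) : Prop := forall k : nat, 0 < k -> k_CH k G.

(* Main.v *)
(**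
(i) Homogeneity of stars makes the number c_k of common neighbours of k
vertices with at least one common neighbour depend only on k <= 4. Counting
edges in extensions of complete bipartite subgraphs K_{l,r} gives
(c_l - r)(c_{r+1} - l) = (c_r - l)(c_{l+1} - r). With d, m, t = c_1, c_2, c_3
and m >= 3, the cases (l,r) = (2,1), (3,1), (3,2) combine to
(t - m)^2 (t - m + 1) = 0, whence d = m or d = m + 1. If m = 2 and d >= 4, then
two non-equivalent prolongations of a path of length 3 rule out diameter > 2,
and homogeneity of forks yields d = 5. In each of the three cases (complete
bipartite graphs, complete bipartite graphs minus a perfect matching, the
folded 5-cube) there is, for any connected set S and vertices v, w outside S
with the same non-empty set of neighbours in S, an automorphism fixing S
pointwise and taking v to w; extending isomorphisms vertex by vertex, the graph
is CH.

(ii) The hypercubes Q_n with n >= 4 are 4-CH, as the same one-point extensions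
can be made by exchanging two coordinates. They are not 5-CH: the ends of an
induced path with 5 vertices may be at distance 2 or 4.
*)

From Stdlib Require Import ZArith.
Require Import Defs.
From mathcomp Require Import all_boot perm zify.

Set Implicit Arguments.
Unset Strict Implicit.
Unset Printing Implicit Defensive.

(** * Homogeneity in terms of sequences of vertices *)

Section Sequences.
Variable G : sgraph.
Implicit Types (x y v w : G) (s t : seq G).

(** The head is the newest vertex, so every suffix is connected. This makes induction by one vertex
    possible within connected subgraphs. *)
Fixpoint grown s :=
  if s is v :: s' then [&& v \notin s', nilp s' || has (adj v) s' & grown s']
  else true.

Fixpoint same_adj s t :=
  match s, t with
  | [::], [::] => true
  | v :: s', w :: t' =>
      (map (adj v) s' == map (adj w) t') && same_adj s' t'
  | _, _ => false
  end.

(** The isomorphism is the positional matching of [s] with [t]. Connectedness is asked of [s] only,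
    since [same_adj_grown] transfers it to [t]. *)
Definition seq_CH k := forall s t,
  size s <= k -> grown s -> uniq t -> same_adj s t ->
  exists2 g : G -> G, is_isom g & map g s = t.

Lemma adjC x y : adj x y = adj y x.
Proof. exact: adj_sym. Qed.

Lemma is_isom_id : is_isom (@id G).
Proof. by split=> //; exists id. Qed.

Lemma is_isom_comp (g h : G -> G) : is_isom g -> is_isom h -> is_isom (g \o h).
Proof.
move=> [bg ag] [bh ah]; split; first exact: bij_comp.
by move=> x y /=; rewrite ag ah.
Qed.

Lemma grown_uniq s : grown s -> uniq s.
Proof. by elim: s => //= v s IH /and3P[-> _ /IH]. Qed.

Lemma same_adj_size s t : same_adj s t -> size s = size t.
Proof. by elim: s t => [|v s IH] [|w t] //= /andP[_ /IH ->]. Qed.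

Lemma same_adj_nth s t x0 i j : same_adj s t -> i < size s -> j < size s ->
  adj (nth x0 s i) (nth x0 s j) = adj (nth x0 t i) (nth x0 t j).
Proof.
elim: s t i j => [|v s IH] [|w t] [|i] [|j] //= /andP[/eqP E st] Hi Hj.
- by rewrite !adj_irr.
- have Hj' : j < size t by rewrite -(same_adj_size st).
  by rewrite -(nth_map x0 false (adj v)) // E (nth_map x0).
- have Hi' : i < size t by rewrite -(same_adj_size st).
  by rewrite ![adj _ v]adjC ![adj _ w]adjC -(nth_map x0 false (adj v)) // E (nth_map x0).
- exact: IH.
Qed.

Lemma same_adj_grown s t : same_adj s t -> uniq t -> grown s -> grown t.
Proof.
elim: s t => [|v s IH] [|w t] //= /andP[/eqP E st] /andP[-> ut] /and3P[_ H gs].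
rewrite (IH _ st ut gs) andbT /= /nilp -(same_adj_size st).
move: H; rewrite /nilp; case: eqP => //= _.
by rewrite -[has _ s](has_map (adj v) id) E has_map.
Qed.

Definition adj_in s : rel G := [rel x y | [&& x \in s, y \in s & adj x y]].

Lemma adj_in_sym s : connect_sym (adj_in s).
Proof.
by apply: sym_connect_sym => x y; rewrite /adj_in /= andbCA [adj x y]adjC.
Qed.

Lemma grown_connect_in s : grown s -> {in s &, forall x y, connect (adj_in s) x y}.
Proof.
elim: s => //= v s IH /and3P[_ Hv /IH{}IH].
have mono x y : connect (adj_in s) x y -> connect (adj_in (v :: s)) x y.
  apply: connect_sub => {}x {}y /and3P[xs ys xy].
  by apply: connect1; rewrite /adj_in /= !inE xs ys xy !orbT.
have cv x : x \in v :: s -> connect (adj_in (v :: s)) v x.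
  rewrite inE => /predU1P[-> | xs]; first exact: connect0.
  case/orP: Hv => [/nilP E | /hasP[z zs vz]]; first by rewrite E in xs.
  apply: (@connect_trans _ _ z); last exact/mono/IH.
  by apply: connect1; rewrite /adj_in /= !inE eqxx zs vz orbT.
move=> x y xs ys; apply: (@connect_trans _ _ v); last exact: cv.
by rewrite adj_in_sym cv.
Qed.

Lemma grown_connect s : grown s -> {in s &, forall x y, connect (@adj G) x y}.
Proof.
move=> gs x y xs ys; apply: connect_sub (grown_connect_in gs xs ys) => x' y'.
by case/and3P=> _ _; apply: connect1.
Qed.

Lemma grown_induced s (A_n0 : [set x in s] != set0) :
  grown s -> connected (induced A_n0).
Proof.
move=> gs x y.
have xs : val x \in s by have := valP x; rewrite inE.
have ys : val y \in s by have := valP y; rewrite inE.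
case/connectP: (grown_connect_in gs xs ys) => p.
elim: p x xs => /= [|z p IH] x xs.
  by move=> _ /val_inj ->; apply: connect0.
case/andP=> /and3P[_ zs xz] pp lp.
have zA : z \in [set x in s] by rewrite inE.
apply: (@connect_trans _ _ (Sub z zA)); last exact: IH.
exact: connect1.
Qed.

(** A non-empty list that no outside vertex can extend is closed under adjacency, hence exhausts a
    connected graph. *)
Lemma connected_grown : connected G -> exists2 s, grown s & s =i G.
Proof.
move=> cG.
have H n : n <= #|G| -> exists2 s, grown s & size s = n.
  elim: n => [_|n IH nG]; first by exists [::].
  have [s gs sn] := IH (ltnW nG).
  have cs : #|s| < #|G| by rewrite (card_uniqP (grown_uniq gs)) sn.
  have [y _ ys] : exists2 y, y \in G & y \notin s.
    by apply/subsetPn; apply: contraL cs => /subset_leq_card; rewrite -leqNgt.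
  have [/hasP[x xs _]|] := boolP (has predT s); last first.
    rewrite has_predT -leqNgt leqn0 => /nilP s0.
    by exists [:: y] => //=; rewrite -sn s0.
  have [/existsP[v /andP[vs hv]] | /existsPn no] :=
    boolP [exists v, (v \notin s) && has (adj v) s].
    by exists (v :: s); rewrite /= ?vs ?hv ?orbT // sn.
  have cl : closed (@adj G) (mem s).
    move=> a b ab; apply/idP/idP => [as_|bs]; apply/negPn/negP => nin.
      by have := no b; rewrite nin /= => /hasPn/(_ a as_); rewrite adjC ab.
    by have := no a; rewrite nin /= => /hasPn/(_ b bs); rewrite ab.
  have : (x \in s) = (y \in s) := closed_connect cl (cG x y).
  by rewrite xs (negPf ys).
have [s gs sn] := H _ (leqnn _); exists s => // x.
have /subset_cardP/(_ (subset_predT _)) : #|s| = #|G|; last by move->.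
by rewrite (card_uniqP (grown_uniq gs)) sn.
Qed.

Lemma k_CH_seq k : k_CH k G -> seq_CH k.
Proof.
move=> H s t sk gs ut st; case: s => [|x0 s0] in sk gs st *.
  (* Induced subgraphs are non-empty, so the empty list is treated apart. *)
  by case: t st {ut} => // _; exists id => //; apply: is_isom_id.
set s := x0 :: s0 in sk gs st *; have us := grown_uniq gs.
have sz := same_adj_size st.
have A_n0 : [set x in s] != set0.
  by apply/set0Pn; exists x0; rewrite inE mem_head.
pose F x := nth x0 t (index x s).
have FB x : x \in [set x in s] -> F x \in [set x in t].
  by rewrite !inE => xs; rewrite mem_nth // -sz index_mem.
have B_n0 : [set x in t] != set0.
  by apply/set0Pn; exists (F x0); apply: FB; rewrite inE mem_head.
have cA : #|[set x in s]| = size s by rewrite cardsE; apply/card_uniqP.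
have cB : #|[set x in t]| = size t by rewrite cardsE; apply/card_uniqP.
pose f (x : induced A_n0) : induced B_n0 := Sub (F (val x)) (FB _ (valP x)).
have vs (x : induced A_n0) : val x \in s by have := valP x; rewrite inE.
have idx (x : induced A_n0) : index (val x) s < size s by rewrite index_mem.
have fiso : is_isom f.
  split; last first.
    move=> x y; rewrite /= /induced_adj /= -(same_adj_nth x0 st) ?idx //.
    by rewrite (nth_index x0 (vs x)) (nth_index x0 (vs y)).
  apply: inj_card_bij; last by rewrite !card_sig cA cB sz.
  move=> x y /(congr1 val) /= /eqP; rewrite nth_uniq -?sz ?idx // => /eqP E.
  by apply: val_inj; rewrite -(nth_index x0 (vs x)) E (nth_index x0 (vs y)).
have [||||g giso gf] := H _ _ A_n0 B_n0 f _ _ _ _ fiso.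
- exact: grown_induced.
- by apply: grown_induced; apply: same_adj_grown st ut gs.
- by rewrite cA.
- by rewrite cB -sz.
exists g => //; apply: (@eq_from_nth _ x0); first by rewrite size_map.
move=> i; rewrite size_map => Hi; rewrite (nth_map x0) //.
have xA : nth x0 s i \in [set x in s] by rewrite inE mem_nth.
by have /= -> := gf (exist (fun x => x \in [set x in s]) _ xA); rewrite /F index_uniq.
Qed.

(** A path on four vertices has no such [z]. For hypercubes this keeps the vertices of a short list
    within distance 2 of one another. *)
Lemma grown_star s : grown s -> 0 < size s < 4 ->
  exists z, {in s, forall y, y = z \/ adj z y}.
Proof.
case: s => [|p [|q [|r [|]]]] //=.
- by exists p => y; rewrite inE => /eqP; left.
- rewrite orbF => /and3P[_ pq _] _; exists p => y.
  by rewrite !inE => /orP[]/eqP->; [left | right].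
- rewrite !orbF => /and3P[_ pqr /and3P[_ qr _]] _.
  case/orP: pqr => [pq|pr].
    exists q => y; rewrite !inE.
    by case/or3P => /eqP->; [right; rewrite adjC | left | right].
  exists r => y; rewrite !inE.
  by case/or3P => /eqP->; [right; rewrite adjC | right; rewrite adjC | left].
Qed.

Definition twins_in s v w := {in s, forall x, adj v x = adj w x}.

Definition fixing_aut s v w :=
  exists2 g : G -> G, is_isom g & {in s, g =1 id} /\ g v = w.

(** Once [g] carries the older vertices to their images, the target of the newest one is pulled back
    along [g]; an automorphism fixing the older vertices then moves the newest one there. *)
Lemma seq_CH_step k :
  (forall s v w, size s < k -> grown s -> v \notin s -> w \notin s ->
     nilp s || has (adj v) s -> twins_in s v w -> fixing_aut s v w) ->
  seq_CH k.
Proof.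
move=> H; elim=> [|v s IH] [|w t] //=.
  by move=> *; exists id => //; apply: is_isom_id.
move=> sk /and3P[vs hv gs] /andP[wt ut] /andP[/eqP E st].
have [g giso gs_t] := IH t (ltnW sk) gs ut st.
have [[g' gK g'K] ag] := giso.
have [|x xs|h hiso [hs hv']] := H s v (g' w) sk gs vs _ hv.
- by apply: contra wt => ws; rewrite -gs_t -[w]g'K map_f.
- rewrite -(ag (g' w)) g'K.
  have : adj v x = nth false (map (adj v) s) (index x s).
    by rewrite (nth_map x) ?index_mem // nth_index.
  rewrite E -gs_t -map_comp => ->.
  by rewrite (nth_map x) ?index_mem //= nth_index.
exists (g \o h); first exact: is_isom_comp.
rewrite /= hv' g'K -gs_t; congr (_ :: _).
by apply/eq_in_map => x /hs /= ->.
Qed.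

End Sequences.

Lemma grown_map (G H : sgraph) (h : G -> H) s : injective h ->
  (forall x y, adj (h x) (h y) = adj x y) -> grown (map h s) = grown s.
Proof.
move=> hi ha; elim: s => //= v s ->; rewrite mem_map // has_map.
by rewrite (eq_has (a2 := adj v)) /nilp ?size_map // => x /=; rewrite ha.
Qed.

Lemma same_adj_map (G H : sgraph) (h h' : G -> H) s :
  (forall x y, adj (h x) (h y) = adj x y) ->
  (forall x y, adj (h' x) (h' y) = adj x y) ->
  same_adj (map h s) (map h' s).
Proof.
move=> ha ha'; elim: s => //= v s ->; rewrite andbT -!map_comp.
by apply/eqP/eq_map => x /=; rewrite ha ha'.
Qed.

Lemma seq_k_CH (G : sgraph) k : seq_CH G k -> k_CH k G.
Proof.
move=> H A B A_n0 B_n0 f cA _ Ak _ [bf af].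
have [s gs sG] := connected_grown cA.
have fi := bij_inj bf.
have [||||g giso gs_t] := H (map val s) (map (val \o f) s).
- have := card_uniqP (grown_uniq gs).
  by rewrite (eq_card sG) card_sig size_map => <-.
- by rewrite (@grown_map (induced A_n0) G _ s val_inj).
- rewrite map_inj_uniq ?grown_uniq //.
  by apply: inj_comp => //; apply: val_inj.
- by apply: (@same_adj_map (induced A_n0) G) => // x y; rewrite -af.
exists g => // x.
have xs : x \in s by rewrite sG.
by move: gs_t; rewrite -map_comp => /eq_in_map/(_ x xs).
Qed.

(** * Finite 5-CH graphs of girth 4 *)

Lemma double_count (T : finType) (A B : {set T}) (r : rel T) p q :
  {in A, forall x, #|[set y in B | r x y]| = p} ->
  {in B, forall y, #|[set x in A | r x y]| = q} ->
  #|A| * p = #|B| * q.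
Proof.
move=> HA HB.
have E C (P : pred T) : #|[set x in C | P x]| = \sum_(x in C) P x.
  by rewrite -sum1_card big_mkcond [RHS]big_mkcond; apply: eq_bigr => x _;
    rewrite !inE; case: (x \in C); case: (P x).
rewrite -!sum_nat_const -(eq_bigr _ HA) -(eq_bigr _ HB).
under eq_bigr do rewrite E.
under [RHS]eq_bigr do rewrite E.
by rewrite exchange_big.
Qed.

(** The first equation yields [(d - 3) * (t - 1)] and the third [(m - 3) * (s - 1)] in terms of [m]
    and [t]. By the second, their product is the square of [(t - 1) * (m - 3)], which eliminates [d]
    and [s]. *)
Lemma cubic_roots (d m t s : Z) :
  ((m - 1) * (m - 2) = (d - 2) * (t - 1) ->
  (t - 1) * (m - 3) = (d - 3) * (s - 1) ->
  (t - 2) * (t - 3) = (m - 3) * (s - 2) -> t = m \/ t = m - 1)%Z.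
Proof.
move=> E1 E2 E3.
have A : ((d - 3) * (t - 1) = (m - 1) * (m - 2) - (t - 1))%Z by lia.
have B : ((m - 3) * (s - 1) = (t - 2) * (t - 3) + (m - 3))%Z by lia.
have P : ((t - 1) * (m - 3) * ((t - 1) * (m - 3)) =
  (d - 3) * (t - 1) * ((m - 3) * (s - 1)))%Z by rewrite {1}E2; ring.
rewrite A B in P.
have /Z.mul_eq_0[/Z.mul_eq_0[] | ] : ((t - m) * (t - m) * (t - m + 1) = 0)%Z by lia.
all: lia.
Qed.

(** The root [t = m] gives [d = m], and [t = m - 1] gives [d = m + 1]. The work lies in passing from
    truncated to integer subtraction. *)
Lemma count_arith d m t s : 3 <= m -> 2 <= t <= m -> 0 < s ->
  (m - 1) * (m - 2) = (d - 2) * (t - 1) ->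
  (t - 1) * (m - 3) = (d - 3) * (s - 1) ->
  (t - 2) * (t - 3) = (m - 3) * (s - 2) ->
  d <= m.+1.
Proof.
move=> m3 /andP[t2 tm] s0 E1 E2 E3; rewrite leqNgt; apply/negP => dm.
(* For [s = 1] the difference [s - 2] is truncated; the second equation then forces [m = 3], because
   [t > 1]. *)
case: (ltngtP s 1) s0 => // [s2 | s1] _; last first.
  move: E2; rewrite s1 subnn muln0 => /eqP; rewrite muln_eq0 => /orP[] M0; first by lia.
  have ? : m = 3 by lia.
  subst m; have [?|?] : t = 2 \/ t = 3 by lia.
    by subst; lia.
  by subst; lia.
have sub n k : k <= n -> Z.of_nat (n - k) = (Z.of_nat n - Z.of_nat k)%Z by lia.
have [||||] := @cubic_roots (Z.of_nat d) (Z.of_nat m) (Z.of_nat t) (Z.of_nat s).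
- by rewrite -!(sub _ 1) -?(sub _ 2); lia.
- by rewrite -!(sub _ 1) -?(sub _ 3); lia.
(* For [t = 2] the difference [t - 3] is truncated, but its cofactor [t - 2] vanishes. *)
- case: (ltngtP t 2) t2 => // [t3 | t_2] _.
    by rewrite -!(sub _ 2) -?(sub _ 3); lia.
  move/esym/eqP: E3; rewrite t_2 subnn mul0n muln_eq0 => /orP[] ?.
    by rewrite (_ : m = 3); lia.
  by rewrite (_ : s = 2); lia.
- move=> ?; have ? : t = m by lia.
  subst t; have /eqP := E1; rewrite mulnC eqn_pmul2r; lia.
- move=> ?; have ? : t = m - 1 by lia.
  subst t; have /eqP := E1; rewrite -subnDA eqn_pmul2r; lia.
Qed.

(** * Common neighbours in triangle-free 5-CH graphs *)

Section FiveCH.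
Variable G : sgraph.
Hypothesis seqG : seq_CH G 5.
Hypothesis noK3 : forall x y z : G, adj x y -> adj y z -> adj x z -> False.
Implicit Types (x y z u v w a b c e p q : G) (l s t L R : seq G).

Definition common_nbrs l := [set x : G | all (adj x) l].

Lemma isom_adjC (g : G -> G) : is_isom g -> forall x y, adj (g x) (g y) = adj x y.
Proof. by case. Qed.

Lemma isom_inj (g : G -> G) : is_isom g -> injective g.
Proof. by case=> /bij_inj. Qed.

Lemma isom_common_nbrs (g : G -> G) l x : is_isom g ->
  (g x \in common_nbrs (map g l)) = (x \in common_nbrs l).
Proof.
by move=> [_ ag]; rewrite !inE all_map; apply: eq_all => y /=; rewrite ag.
Qed.

Lemma vertex_transitive x y : exists2 g : G -> G, is_isom g & g x = y.
Proof. by case: (@seqG [:: x] [:: y]) => // g ig [gx]; exists g. Qed.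

Lemma star_grown u l : uniq l -> u \in common_nbrs l -> grown (rcons l u).
Proof.
elim: l => //= v l IH /andP[vl ul]; rewrite inE /= => /andP[uv H].
rewrite IH ?inE // andbT mem_rcons inE negb_or vl andbT.
rewrite has_rcons adjC uv orbT andbT.
by apply: contraTneq uv => ->; rewrite adj_irr.
Qed.

(** Without triangles the leaves of a star are pairwise non-adjacent, so stars with equally many
    leaves are isomorphic under any matching of leaves. *)
Lemma star_same_adj u w l t : size l = size t ->
  u \in common_nbrs l -> w \in common_nbrs t ->
  same_adj (rcons l u) (rcons t w).
Proof.
elim: l t => [|x l IH] [|y t] //= [sz]; rewrite !inE /=.
move=> /andP[ux Hl] /andP[wy Ht]; rewrite IH ?inE // andbT !map_rcons.
rewrite adjC ux adjC wy eqseq_rcons andbT.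
have E z v k : adj v z -> all (adj v) k -> map (adj z) k = nseq (size k) false.
  move=> vz; elim: k => //= y' k IHk /andP[vy' /IHk ->]; congr (_ :: _).
  by apply/negP => /(noK3 vz); apply.
by rewrite (E x u) // (E y w) // sz.
Qed.

(** A star with four leaves has five vertices, the order that 5-CH allows. An automorphism taking
    [l] to [t] injects the common neighbours of [l] into those of [t]. *)
Lemma leq_common_nbrs l t : uniq l -> uniq t -> size l = size t -> size l <= 4 ->
  common_nbrs l != set0 -> common_nbrs t != set0 ->
  #|common_nbrs l| <= #|common_nbrs t|.
Proof.
move=> ul ut sz l4 /set0Pn[u uL] /set0Pn[w wT].
have [||||g ig] := seqG (s := rcons l u) (t := rcons t w).
- by rewrite size_rcons.
- exact: star_grown.
- exact/grown_uniq/star_grown.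
- exact: star_same_adj.
rewrite map_rcons => /eqP; rewrite eqseq_rcons => /andP[/eqP gl _].
rewrite -(card_imset _ (isom_inj ig)); apply: subset_leq_card.
by apply/subsetP => _ /imsetP[x xL ->]; rewrite -gl isom_common_nbrs.
Qed.

Lemma card_common_nbrs l t : uniq l -> uniq t -> size l = size t -> size l <= 4 ->
  common_nbrs l != set0 -> common_nbrs t != set0 ->
  #|common_nbrs l| = #|common_nbrs t|.
Proof.
move=> ul ut sz l4 nl nt; apply/eqP; rewrite eqn_leq.
by rewrite !leq_common_nbrs -?sz.
Qed.

(** Both sides count the edges between the common neighbours of [L] outside [R] and the common
    neighbours of [R] outside [L]. A vertex [y] of the first set has [c (size R).+1] common
    neighbours with [R], and these include all of [L]. *)
Lemma common_nbrs_count (c : nat -> nat) :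
  (forall l, uniq l -> 0 < size l <= 4 -> common_nbrs l != set0 ->
     #|common_nbrs l| = c (size l)) ->
  forall L R, uniq L -> uniq R -> 0 < size L < 4 -> 0 < size R < 4 ->
    {in L & R, forall x y, adj x y} ->
  (c (size L) - size R) * (c (size R).+1 - size L) =
  (c (size R) - size L) * (c (size L).+1 - size R).
Proof.
move=> Hc L R uL uR sL sR LR.
have card_diff (k : seq G) (A : {set G}) : uniq k -> {subset k <= A} ->
    #|A :\: [set x in k]| = #|A| - size k.
  move=> uk kA; rewrite cardsD; congr (_ - _).
  rewrite -(card_uniqP uk) -cardsE; apply: eq_card => x; rewrite !inE.
  by apply: andb_idl => /kA.
have half (L' R' : seq G) : uniq L' -> uniq R' -> 0 < size L' < 4 ->
    0 < size R' < 4 -> {in L' & R', forall x y, adj x y} ->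
    #|common_nbrs L' :\: [set x in R']| = c (size L') - size R' /\
    {in common_nbrs L' :\: [set x in R'], forall y,
      #|[set z in common_nbrs R' :\: [set x in L'] | adj y z]|
        = c (size R').+1 - size L'}.
  move=> uL' uR' sL' sR' LR'.
  have RL : {subset R' <= common_nbrs L'}.
    by move=> y yR; rewrite inE; apply/allP => x xL; rewrite adjC LR'.
  have LR2 : {subset L' <= common_nbrs R'}.
    by move=> y yL; rewrite inE; apply/allP => x xR; rewrite LR'.
  split.
    rewrite card_diff // Hc //; first by case/andP: sL' => -> /ltnW.
    case: R' sR' RL {uR' LR' LR2} => // y R' _ RL.
    by apply/set0Pn; exists y; apply: RL; rewrite mem_head.
  move=> y /setDP[yL yR]; rewrite inE in yR; rewrite inE in yL.
  rewrite -(Hc (y :: R')) /= ?yR //; last first.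
  - case: L' sL' LR2 yL {uL' LR' RL} => // x L' _ LR2 /= /andP[yx _].
    apply/set0Pn; exists x; have := LR2 x (mem_head _ _).
    by rewrite !inE /= adjC yx.
  - by case/andP: sR'.
  rewrite -(card_diff L') //; last first.
    move=> x xL; have := LR2 x xL; rewrite !inE /= => ->.
    by rewrite adjC (allP yL).
  apply: eq_card => x; rewrite !inE /= [adj y x]adjC.
  by case: (x \in L'); case: (adj x y); case: all.
have [cL hL] := half _ _ uL uR sL sR LR.
have [y x yR xL|cR hR] := half _ _ uR uL sR sL.
  by rewrite adjC LR.
rewrite -cL -cR; apply: (double_count hL) => y yR.
rewrite -(hR y yR); apply: eq_card => x; rewrite !inE.
by rewrite [adj x y]adjC.
Qed.

Definition regular_nbrs d := forall x, #|common_nbrs [:: x]| = d.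
Definition regular_common_nbrs m := forall x y z, x != y -> adj z x -> adj z y ->
  #|common_nbrs [:: x; y]| = m.

(** The map exchanges [v] with [w] and [p] with [q]. The case [p = q] is allowed and leaves a single
    transposition. *)
Lemma double_swap_isom v w p q :
  v != w -> p \notin [:: v; w] -> q \notin [:: v; w] ->
  (forall y, y \notin [:: v; w; p; q] -> adj y v = adj y w) ->
  (forall y, y \notin [:: v; w; p; q] -> adj y p = adj y q) ->
  adj p v = adj q w -> adj p w = adj q v ->
  exists2 g : G -> G, is_isom g &
    [/\ g v = w, g p = q & forall y, y \notin [:: v; w; p; q] -> g y = y].
Proof.
rewrite !inE !negb_or => vw /andP[pv pw] /andP[qv qw] Hv Hp pv_qw pw_qv.
pose g x := if x == v then w else if x == w then v else
            if x == p then q else if x == q then p else x.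
have gv : g v = w by rewrite /g eqxx.
have gw : g w = v by rewrite /g eqxx eq_sym (negPf vw).
have gp : g p = q by rewrite /g (negPf pv) (negPf pw) eqxx.
have gq : g q = p.
  by rewrite /g (negPf qv) (negPf qw) eqxx; case: eqP => [->|].
have gn y : y \notin [:: v; w; p; q] -> g y = y.
  by rewrite !inE !negb_or /g => /and4P[/negPf-> /negPf-> /negPf-> /negPf->].
have gin y : y \in [:: v; w; p; q] -> [\/ y = v, y = w, y = p | y = q].
  by rewrite !inE => /or4P[] /eqP->; [constructor 1|constructor 2|constructor 3|constructor 4].
exists g; last by [].
split.
  apply: inv_bij => y; have [/gin[] ->|yn] := boolP (y \in [:: v; w; p; q]).
  - by rewrite gv gw.
  - by rewrite gw gv.
  - by rewrite gp gq.
  - by rewrite gq gp.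
  - by rewrite !gn.
have half x y : x \in [:: v; w; p; q] -> y \notin [:: v; w; p; q] ->
    adj (g x) (g y) = adj x y.
  move=> /gin[] -> yn; rewrite (gn y yn) ?gv ?gw ?gp ?gq ![adj _ y]adjC.
  - by rewrite Hv.
  - by rewrite Hv.
  - by rewrite Hp.
  - by rewrite Hp.
move=> x y.
have [xi|xn] := boolP (x \in [:: v; w; p; q]);
  have [yi|yn] := boolP (y \in [:: v; w; p; q]).
- case/gin: xi => ->; case/gin: yi => ->; rewrite ?gv ?gw ?gp ?gq ?adj_irr //;
  move: (adjC v w) (adjC v p) (adjC v q) (adjC w p) (adjC w q) (adjC p q);
  congruence.
- exact: half.
- by rewrite adjC [RHS]adjC half.
- by rewrite !gn.
Qed.

(** * One-point extensions, by degree [d] and number [m] of common neighbours of two vertices that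
    have one *)

Section Counting.
Variables d m : nat.
Hypothesis degG : regular_nbrs d.
Hypothesis cmnG : regular_common_nbrs m.

Lemma common_nbrsP l x : reflect {in l, forall y, adj x y} (x \in common_nbrs l).
Proof. by rewrite inE; apply: allP. Qed.

(** The complete bipartite case: the [m = d] common neighbours of [v] and [w] are all the neighbours
    of either, so the transposition of [v] and [w] is an automorphism. *)
Lemma twin_step s v w u : d = m -> v \notin s -> w \notin s ->
  u \in s -> adj v u -> twins_in s v w -> fixing_aut s v w.
Proof.
move=> dm vs ws us vu tw.
have [<-|vw] := eqVneq v w; first by exists id => //; apply: is_isom_id.
have wu : adj w u by rewrite -tw.
have sub z : adj v z = adj w z.
  have c2 : #|common_nbrs [:: v; w]| = m by apply: (cmnG (z := u)); rewrite // adjC.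
  have E k : k \in [:: v; w] -> common_nbrs [:: v; w] = common_nbrs [:: k].
    move=> kvw; apply/eqP; rewrite eqEcard degG c2 dm leqnn andbT.
    by apply/subsetP => x /common_nbrsP H; apply/common_nbrsP => y;
      rewrite inE => /eqP ->; apply: H.
  have /setP/(_ z) : common_nbrs [:: v] = common_nbrs [:: w].
    by rewrite -!E // !inE eqxx ?orbT.
  by rewrite !inE /= !andbT ![adj _ z]adjC.
have uvw : u \notin [:: v; w].
  by rewrite !inE; apply/norP; split; apply: contraTneq us => ->.
(* The second pair is degenerate: [u] is exchanged with itself. *)
have [|||g ig [gv gu gn]] := double_swap_isom vw uvw uvw _ (fun _ _ => erefl).
- by move=> y _; rewrite ![adj y _]adjC.
- by rewrite ![adj u _]adjC.
- by rewrite ![adj u _]adjC.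
exists g => //; split=> // x xs; have [-> //|xu] := eqVneq x u.
apply: gn; rewrite !inE (negPf xu) !orbF; apply/norP.
by split; apply: contraTneq xs => ->.
Qed.

Lemma mem_common2 x a b : (x \in common_nbrs [:: a; b]) = adj x a && adj x b.
Proof. by rewrite !inE /= andbT. Qed.

(** In a complete bipartite graph minus a perfect matching, [p] is the vertex matched with [w]. It
    is unique because [d - m = 1]. *)
Lemma unique_diff v w u : d = m.+1 -> v != w -> adj u v -> adj u w ->
  exists p, forall y, adj y v && ~~ adj y w = (y == p).
Proof.
move=> dm vw uv uw.
have : #|common_nbrs [:: v] :\: common_nbrs [:: w]| == 1.
  rewrite cardsD degG (_ : _ :&: _ = common_nbrs [:: v; w]).
    by rewrite (cmnG vw uv uw) dm subSnn.
  by apply/setP => y; rewrite !inE /= !andbT.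
case/cards1P => p /setP E; exists p => y.
by have := E y; rewrite !inE /= !andbT andbC.
Qed.

(** Here [p] and [q] are the partners of [w] and [v]. Used in both directions, this shows that [p]
    and [q] have the same neighbours apart from [v] and [w]. *)
Lemma swap_partners v w p q c c' y : d = m.+1 ->
  adj v p -> ~~ adj w p -> adj w q -> ~~ adj v q ->
  c != c' -> adj c v -> adj c w -> adj c' v -> adj c' w ->
  adj y p -> y != v -> adj y q.
Proof.
move=> dm vp wp wq vq cc cv cw c'v c'w yp yv.
(* By [unique_diff], [w] is the only neighbour of [k] not adjacent to [p], and [v] the only one not
   adjacent to [q]. *)
have near k z : adj k v -> adj k w -> adj z k ->
    (z != w -> adj z p) /\ (z != v -> adj z q).
  move=> kv kw zk; split=> zn; apply/negPn/negP => no.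
    have kp : k != p by apply: contraNneq wp => <-; rewrite adjC.
    have [||e He] := unique_diff dm kp (u := v) => //; first by rewrite adjC.
    have := He w; rewrite adjC kw wp => /esym/eqP we.
    by move: zn; rewrite we -He zk no.
  have kq : k != q by apply: contraNneq vq => <-; rewrite adjC.
  have [||e He] := unique_diff dm kq (u := w) => //; first by rewrite adjC.
  have := He v; rewrite adjC kv vq => /esym/eqP we.
  by move: zn; rewrite we -He zk no.
have [yc|yc] := boolP (adj y c); first exact: (near c y cv cw yc).2.
have [yc'|yc'] := boolP (adj y c'); first exact: (near c' y c'v c'w yc').2.
(* Now [y] is adjacent to neither [c] nor [c']. The neighbour [f] of [c'] missed by [c] is adjacent
   to [p]; as [p] has just one neighbour missed by [c], [y] equals [f], which is adjacent to
   [c']. *)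
have pc : p != c by apply: contraNneq wp => ->; rewrite adjC.
have [||e He] := unique_diff dm pc (u := v) => //; first by rewrite adjC.
have c'c : c' != c by rewrite eq_sym.
have [||f Hf] := unique_diff dm c'c (u := v) => //; try by rewrite adjC.
have /andP[fc' fc] : adj f c' && ~~ adj f c by rewrite Hf.
have fw : f != w by apply: contraNneq fc => ->; rewrite adjC.
have [fp _] := near _ _ c'v c'w fc'.
have /eqP fe : f == e by rewrite -He fp.
have /eqP ye : y == e by rewrite -He yp yc.
by rewrite ye -fe fc' in yc'.
Qed.

(** The automorphism exchanges [v] and [w] together with their partners. The hypothesis [1 < m]
    supplies the two common neighbours for [swap_partners]. *)
Lemma antipode_step s v w u : d = m.+1 -> 1 < m -> v \notin s -> w \notin s ->
  u \in s -> adj v u -> twins_in s v w -> fixing_aut s v w.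
Proof.
move=> dm m2 vs ws us vu tw.
have [<-|vw] := eqVneq v w; first by exists id => //; apply: is_isom_id.
have wu : adj w u by rewrite -tw.
have uv : adj u v by rewrite adjC.
have uw : adj u w by rewrite adjC.
have [p Hp] := unique_diff dm vw uv uw.
have wv : w != v by rewrite eq_sym.
have [q Hq] := unique_diff dm wv uw uv.
have /andP[pv pw] : adj p v && ~~ adj p w by rewrite Hp.
have /andP[qw qv] : adj q w && ~~ adj q v by rewrite Hq.
have /card_gt1P[c [c' []]] : 1 < #|common_nbrs [:: v; w]| by rewrite (cmnG vw uv uw).
rewrite !mem_common2 => /andP[cv cw] /andP[c'v c'w] cc.
have vw0 : ~~ adj v w by apply/negP => vw_; apply: (noK3 uv vw_ uw).
have [||||||g ig [gv _ gn]] := double_swap_isom (v := v) (w := w) (p := p) (q := q) vw.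
- rewrite !inE; apply/norP; split; first by apply: contraTneq pv => ->; rewrite adj_irr.
  by apply: contraTneq pv => ->; rewrite adjC.
- rewrite !inE; apply/norP; split; last by apply: contraTneq qw => ->; rewrite adj_irr.
  by apply: contraTneq qw => ->.
- move=> y; rewrite !inE !negb_or => /and4P[_ _ yp yq].
  have := Hp y; rewrite (negPf yp); have := Hq y; rewrite (negPf yq).
  by case: (adj y v); case: (adj y w).
- move=> y; rewrite !inE !negb_or => /and4P[yv yw _ _].
  apply/idP/idP => H.
    by apply: (swap_partners dm _ _ _ _ cc cv cw c'v c'w H yv); rewrite adjC.
  by apply: (swap_partners dm _ _ _ _ cc cw cv c'w c'v H yw); rewrite adjC.
- by rewrite pv qw.
- by rewrite (negPf pw) (negPf qv).
(* Neither [p] nor [q] lies in [s], since each is adjacent to exactly one of the twins [v] and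
   [w]. *)
exists g => //; split=> // x xs; apply: gn; rewrite !inE !negb_or.
apply/and4P; split; apply: contraTneq xs => -> //; apply/negP => /tw.
  by rewrite adjC pv [adj w p]adjC (negPf pw).
by rewrite ![adj _ q]adjC qw (negPf qv).
Qed.

(** * Two common neighbours: degree 5 and the folded 5-cube *)

Lemma exists_nbr x l : size l < d -> exists2 z, adj z x & z \notin l.
Proof.
move=> ld; have : ~~ (common_nbrs [:: x] \subset l).
  apply: contraL ld => /subset_leq_card; rewrite degG -leqNgt => /leq_trans; apply.
  exact: card_size.
by case/subsetPn => z; rewrite inE /= andbT; exists z.
Qed.

Lemma common2_eq x y z : m = 2 -> x != y -> adj z x -> adj z y ->
  exists2 k, k != z & forall i, adj i x && adj i y = (i == z) || (i == k).
Proof.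
move=> m2 xy zx zy.
have c2 : #|common_nbrs [:: x; y]| == 2 by rewrite (cmnG xy zx zy) m2.
have /cards2P[a [b [ab E]]] := c2.
have := mem_common2 z x y; rewrite E zx zy !inE.
case/orP => /eqP zE; [exists b | exists a]; rewrite ?zE // 1?eq_sym // => i.
  by rewrite -mem_common2 E !inE.
by rewrite -mem_common2 E !inE orbC.
Qed.

Lemma common2_all x y z k : m = 2 -> x != y -> z != k -> adj z x -> adj z y ->
  adj k x -> adj k y -> forall i, adj i x -> adj i y -> i = z \/ i = k.
Proof.
move=> m2 xy zk zx zy kx ky i ix iy; have [k' _ E] := common2_eq m2 xy zx zy.
have := E k; rewrite kx ky [k == z]eq_sym (negPf zk) => /esym/eqP kE.
by have := E i; rewrite ix iy kE => /esym/orP[]/eqP; [left | right].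
Qed.

Lemma same_adj_cons v w s : map (adj v) s = map (adj w) s ->
  same_adj (v :: s) (w :: s).
Proof.
by move=> /= ->; rewrite eqxx; elim: s => //= x s IH; rewrite eqxx.
Qed.

Lemma noK3F x y z : adj x y -> adj y z -> adj x z = false.
Proof. by move=> xy yz; apply/negP => /(noK3 xy yz). Qed.

(* If y were at distance 3 from u, the path u a x y could be prolonged by a
   neighbour of b as well as by a non-neighbour of b, whereas b, the second
   common neighbour of u and x, is fixed by the pointwise stabiliser of u a x y. *)
Lemma diameter2_step u a x y : m = 2 -> 3 < d -> u != x -> adj a u -> adj a x ->
  adj x y -> adj y u || [exists p, adj p u && adj p y].
Proof.
move=> m2 d4 ux au ax xy; apply/norP => -[yu /existsPn no].
have {}no p : adj p u -> adj p y = false by move=> pu; have := no p; rewrite pu => /negPf.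
have [b ba Eux] := common2_eq m2 ux au ax.
have /andP[bu bx] : adj b u && adj b x by rewrite Eux eqxx orbT.
have yx : adj y x by rewrite adjC.
have ay := no a au; have by_ := no b bu.
have neq k : adj k u -> k != y by move=> ku; apply: contraNneq yu => <-.
have xa : adj x a by rewrite adjC.
have xb : adj x b by rewrite adjC.
(* Besides [x], [x1] is the common neighbour of [a] and [y], and [x2] that of [b] and [y]. *)
have [x1 x1x Eay] := common2_eq m2 (neq a au) xa xy.
have [x2 x2x Eby] := common2_eq m2 (neq b bu) xb xy.
have /andP[x1a x1y] : adj x1 a && adj x1 y by rewrite Eay eqxx orbT.
have /andP[x2b x2y] : adj x2 b && adj x2 y by rewrite Eby eqxx orbT.
have ua : adj u a by rewrite adjC.
have ub : adj u b by rewrite adjC.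
have unk k : adj k y -> u != k by move=> ky; apply: contraNneq yu => ->; rewrite adjC.
have ab : a != b by rewrite eq_sym.
have x12 : x2 != x1.
  apply: contraNneq x2x => E; rewrite E in x2b.
  have := common2_all m2 ab ux ua ub xa xb x1a x2b.
  by case=> e; [have := unk _ x1y | have := x1x]; rewrite e eqxx.
(* Both [z] and [x2] prolong the path, but only [x2] is adjacent to [b]. *)
have [z zy] := exists_nbr y (d4 : size [:: x; x1; x2] < d).
rewrite !inE !negb_or => /and3P[zx zx1 zx2].
have path_adj k : adj k y -> k != x -> k != x1 ->
    map (adj k) [:: y; x; a; u] = [:: true; false; false; false].
  move=> ky kx k1 /=; rewrite ky (noK3F ky yx).
  have -> : adj k a = false.
    by apply/negbTE; have := Eay k; rewrite ky andbT (negPf kx) (negPf k1) => ->.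
  suff -> : adj k u = false by [].
  by apply/negP => /no; rewrite ky.
have pz := path_adj z zy zx zx1.
have px2 := path_adj x2 x2y x2x x12.
have nin k : map (adj k) [:: y; x; a; u] = [:: true; false; false; false] ->
    k != x -> k \notin [:: y; x; a; u].
  move=> [ky kx ka ku] kx'; rewrite !inE !negb_or kx' /=; apply/and3P; split.
  - by apply: contraTneq ky => ->; rewrite adj_irr.
  - by apply: contraFneq kx => ->.
  - by apply: contraFneq ka => ->.
have yu' : y != u by apply: contraTneq xy => ->; rewrite (noK3F xa au).
have xy' : y != x by apply: contraTneq xy => ->; rewrite adj_irr.
have xa' : x != a by apply: contraTneq xa => ->; rewrite adj_irr.
have au' : a != u by apply: contraTneq au => ->; rewrite adj_irr.
have g4 : grown [:: y; x; a; u].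
  rewrite /= yx xa au !inE !negb_or ?andbT yu' xy' xa' au'.
  by rewrite [y == a]eq_sym neq // [x == u]eq_sym ux.
have [||||g ig [gx2 gy gx ga gu]] := @seqG [:: x2; y; x; a; u] [:: z; y; x; a; u].
- by [].
- by rewrite /= -/(grown [:: y; x; a; u]) g4 nin // x2y.
- by rewrite cons_uniq nin // (grown_uniq g4).
- by apply: same_adj_cons; rewrite pz.
have gb : g b = b.
  have := Eux (g b); rewrite -{1}gu -{1}gx !(isom_adjC ig) bu bx => /esym/orP[]/eqP //.
  by move=> gba; move: ba; rewrite -(inj_eq (isom_inj ig)) gba ga eqxx.
have := Eby z; rewrite -gx2 -{1}gb -gy !(isom_adjC ig) x2b x2y.
by rewrite gx2 (negPf zx) (negPf zx2).
Qed.

(** Adjacency matches the two common neighbours of [x] and [c] with the [d - 3] neighbours of [u]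
    other than [a], [b], [c]; hence [d - 3 = 2]. *)
Lemma degree5 u x a : m = 2 -> 3 < d -> u != x -> adj a u -> adj a x -> d = 5.
Proof.
move=> m2 d4 ux au ax; have [b ba Eux] := common2_eq m2 ux au ax.
have ua : adj u a by rewrite adjC.
have xa : adj x a by rewrite adjC.
have /andP[bu bx] : adj b u && adj b x by rewrite Eux eqxx orbT.
have xu0 : adj x u = false by apply: noK3F xa au.
have [y yx] := exists_nbr x (ltnW d4 : size [:: a; b] < d).
rewrite !inE => /norP[ya yb].
have xy : adj x y by rewrite adjC.
have ya0 : adj a y = false by apply: noK3F ax xy.
have nbr_u k : adj k u -> k != a -> k != b -> adj k x = false.
  by move=> ku ka kb; have := Eux k; rewrite ku (negPf ka) (negPf kb).
have not_u k : adj k x -> k != a -> k != b -> adj k u = false.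
  by move=> kx ka kb; have := Eux k; rewrite kx (negPf ka) (negPf kb) andbT.
have yu0 := not_u y yx ya yb.
have := diameter2_step m2 d4 ux au ax xy; rewrite yu0 /=.
case/existsP=> c /andP[cu cy].
have nab k i : adj k u -> adj i u -> adj k i = false.
  by move=> ku iu; apply: (noK3F (y := u)); rewrite // adjC.
have c_ab z k : adj z x -> adj k z -> k != a /\ k != b.
  move=> zx kz; split; apply: contraTneq kz => ->.
    by rewrite (noK3F ax) // adjC.
  by rewrite (noK3F bx) // adjC.
have [ca cb] := c_ab _ _ yx cy.
have yc : adj y c by rewrite adjC.
have xc0 : adj c x = false by apply: nbr_u.
have xc : x != c by apply: contraTneq cu => <-; rewrite xu0.
have uy : u != y by apply: contraFneq xu0 => ->.
have [e ec Euy] := common2_eq m2 uy cu cy.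
have /andP[eu ey] : adj e u && adj e y by rewrite Euy eqxx orbT.
have [ea eb] := c_ab _ _ yx ey.
pose A := common_nbrs [:: x; c].
pose B := common_nbrs [:: u] :\: [set a; b; c].
have cA : #|A| = 2 by rewrite -m2; apply: (cmnG xc yx yc).
have cB : #|B| = d - 3.
  rewrite cardsD degG (_ : _ :&: _ = [set a; b; c]).
    by rewrite -setUA cardsU1 cards2 !inE negb_or ![a == _]eq_sym ba ca [b == c]eq_sym cb.
  apply/setP => k; rewrite !inE /= andbT; apply: andb_idl.
  by case/orP=> [/orP[]|] /eqP->.
have cells : #|A| * 1 = #|B| * 1.
  apply: (@double_count _ _ _ (@adj G)) => [z | k].
    (* The vertices [u] and [z] share [c] and exactly one further neighbour [k]. *)
    rewrite mem_common2 => /andP[zx zc].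
    have za : z != a by apply: contraTneq zc => ->; rewrite nab.
    have zb : z != b by apply: contraTneq zc => ->; rewrite nab.
    have zu := not_u z zx za zb.
    have uz : u != z by apply: contraFneq xu0 => ->; rewrite adjC.
    have cz : adj c z by rewrite adjC.
    have [k kc Ek] := common2_eq m2 uz cu cz.
    have /andP[ku kz] : adj k u && adj k z by rewrite Ek eqxx orbT.
    apply/eqP/cards1P; exists k; apply/setP => i; rewrite !inE /= andbT.
    have := Ek i; rewrite [adj z i]adjC.
    have [-> _|ik] := eqVneq i k.
      by have [ka kb] := c_ab _ _ zx kz; rewrite (negPf ka) (negPf kb) (negPf kc) ku kz.
    by rewrite orbF; case: (i == c); rewrite ?orbT // -andbA => ->; rewrite andbF.
  rewrite !inE /= andbT !negb_or => /andP[/andP[/andP[ka kb] kc] ku].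
  have kx := nbr_u k ku ka kb.
  have ex := nbr_u e eu ea eb.
  have nin i : adj i u -> i != a -> i != b -> i != c -> i \notin [:: c; x; a; u].
    move=> iu ia ib ic; rewrite !inE !negb_or ic ia /=; apply/andP; split.
      by apply: contraTneq iu => ->; rewrite xu0.
    by apply: contraTneq iu => ->; rewrite adj_irr.
  have g4 : grown [:: c; x; a; u].
    have cu' : c != u by apply: contraTneq cu => ->; rewrite adj_irr.
    have xa' : x != a by apply: contraTneq xa => ->; rewrite adj_irr.
    have au' : a != u by apply: contraTneq au => ->; rewrite adj_irr.
    rewrite /= cu xa au !inE !negb_or ?orbT ?andbT [c == x]eq_sym xc ca.
    by rewrite [x == u]eq_sym ux cu' xa' au'.
  (* Homogeneity of forks: the star at [u] with leaves [a], [c], [e], prolonged from [a] to [x], has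
     [e] replaced by [k]. Then [g y] is adjacent to [x], [c] and [k], and the only other common
     neighbour of [c] and [k] is [u], which is not adjacent to [x]. *)
  have [||||g ig [ge gc gx _ gu]] := @seqG [:: e; c; x; a; u] [:: k; c; x; a; u].
  - by [].
  - by rewrite /= -/(grown [:: c; x; a; u]) g4 nin // eu !orbT.
  - by rewrite cons_uniq nin // (grown_uniq g4).
  - by apply: same_adj_cons; rewrite /= ku eu kx ex (nab k a) ?(nab k c) ?(nab e a) ?(nab e c).
  apply/eqP/cards1P; exists (g y); apply/setP => i; rewrite !inE /= andbT.
  have gyk : adj (g y) k by rewrite -ge isom_adjC // adjC.
  have gyc : adj (g y) c by rewrite -gc isom_adjC.
  have gyx : adj (g y) x by rewrite -gx isom_adjC.
  have [->|ig'] := eqVneq i (g y); first by rewrite gyx gyc gyk.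
  apply/negP => /andP[/andP[ix ic] ik].
  have uc : adj u c by rewrite adjC.
  have uk : adj u k by rewrite adjC.
  have ck : c != k by rewrite eq_sym.
  have ugy : u != g y by rewrite -{1}gu (inj_eq (isom_inj ig)).
  have [iu|iy] := common2_all m2 ck ugy uc uk gyc gyk ic ik.
    by move: ix; rewrite iu adjC xu0.
  by rewrite iy eqxx in ig'.
by move: cells; rewrite !muln1 cA cB; clear; lia.
Qed.

(** An automorphism fixing [u] and three of its five neighbours while taking [v] to [w] must
    exchange [v] and [w]. It fixes the rest of [s] because each vertex at distance 2 from [u] is
    determined by its two common neighbours with [u]. *)
Lemma clebsch_step s v w u : m = 2 -> d = 5 -> grown s -> v \notin s -> w \notin s ->
  u \in s -> adj v u -> twins_in s v w -> fixing_aut s v w.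
Proof.
move=> m2 d5 gs vs ws us vu tw.
have [<-|vw] := eqVneq v w; first by exists id => //; apply: is_isom_id.
have wu : adj w u by rewrite -tw.
have uv : adj u v by rewrite adjC.
have uw : adj u w by rewrite adjC.
have d4 : 3 < d by rewrite d5.
have ltd l : size l < 5 -> size l < d by rewrite d5.
have [a au] := exists_nbr u (ltd [:: v; w] isT).
have [b bu] := exists_nbr u (ltd [:: v; w; a] isT).
have [c cu] := exists_nbr u (ltd [:: v; w; a; b] isT).
rewrite !inE !negb_or => /and4P[cv cw ca cb] /and3P[bv bw ba] /andP[av aw].
have Nu k : adj k u = (k \in [:: v; w; a; b; c]).
  have uq : uniq [:: v; w; a; b; c].
    by rewrite -rev_uniq /= !inE !negb_or cv cw ca cb bv bw ba av aw eq_sym vw.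
  have ecard : #|[:: v; w; a; b; c]| = #|common_nbrs [:: u]|.
    by rewrite degG d5 (card_uniqP uq).
  have -> : adj k u = (k \in common_nbrs [:: u]) by rewrite !inE /= andbT.
  apply/esym; move: k; apply/(subset_cardP ecard)/subsetP => z.
  by rewrite !inE /= andbT => /or4P[/eqP->|/eqP->|/eqP->|/orP[]/eqP->].
have g0 k : k \in [:: v; w] -> grown [:: k; a; b; c; u].
  rewrite !inE => kvw; apply: (star_grown (l := [:: k; a; b; c])).
    rewrite -rev_uniq /= !inE !negb_or ca cb ba.
    by case/orP: kvw => /eqP->; rewrite ?cv ?cw ?bv ?bw ?av ?aw.
  rewrite !inE /= !(adjC u) au bu cu.
  by case/orP: kvw => /eqP->; rewrite ?vu ?wu.
have uN z : (u \in common_nbrs [:: z; a; b; c]) = adj z u.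
  by rewrite !inE /= !(adjC u) au bu cu !andbT.
have [||||g ig [gv ga gb gc gu]] := @seqG [:: v; a; b; c; u] [:: w; a; b; c; u].
- by [].
- by apply: g0; rewrite inE eqxx.
- by apply/grown_uniq/g0; rewrite !inE eqxx orbT.
- by apply: (@star_same_adj u u [:: v; a; b; c] [:: w; a; b; c]); rewrite ?uN.
have gi := isom_inj ig.
have gw : g w = v.
  have : g w \in [:: v; w; a; b; c] by rewrite -Nu -gu isom_adjC.
  have neq k i : g k = i -> k != w -> g w == i = false.
    by move=> <- kw; rewrite (inj_eq gi) eq_sym (negPf kw).
  rewrite !inE (neq _ _ gv vw) (neq _ _ ga aw) (neq _ _ gb bw) (neq _ _ gc cw).
  by rewrite !orbF => /eqP.
exists g => //; split=> // x xs.
have xv : x != v by apply: contraNneq vs => <-.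
have xw : x != w by apply: contraNneq ws => <-.
(* Induction along a walk from [u]: by [diameter2_step], a further step never leads beyond distance
   2. *)
have near : forall y, connect (@adj G) u y ->
    adj y u || [exists p, adj p u && adj p y].
  move=> y /connectP[l]; elim/last_ind: l y => [|l z IH] y /=.
    by move=> _ ->; apply/orP; right; apply/existsP; exists v; rewrite vu.
  rewrite rcons_path last_rcons => /andP[pl lz] ->.
  case/orP: (IH _ pl erefl) => [lu | /existsP[p /andP[pu pl']]].
    by apply/orP; right; apply/existsP; exists (last u l); rewrite lu.
  have [ul|ul] := eqVneq u (last u l).
    by apply/orP; left; rewrite adjC {1}ul.
  by apply: (@diameter2_step u p (last u l)).
have := near x (grown_connect gs us xs).
have [xu _|xu] /= := boolP (adj x u).
  move: xu; rewrite Nu !inE (negPf xv) (negPf xw) /=.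
  by case/or3P => /eqP ->.
case/existsP => p /andP[pu px].
have [-> //|ux] := eqVneq x u.
have xu' : u != x by rewrite eq_sym.
have [q qp E] := common2_eq m2 xu' pu px.
have /andP[qu qx] : adj q u && adj q x by rewrite E eqxx orbT.
(* Of the neighbours of [u], [g] moves only [v] and [w], which are twins with respect to [x]. *)
have stable k : adj k u -> adj k x -> adj (g k) x.
  rewrite Nu !inE => /or4P[/eqP->|/eqP->|/eqP->|/orP[]/eqP->];
  by rewrite ?gv ?gw ?ga ?gb ?gc // ![adj _ x]adjC ![adj x _]adjC tw.
have gpq : g p != g q by rewrite (inj_eq gi) eq_sym.
have adj_g k : adj k u -> adj k x -> [/\ adj u (g k), adj x (g k) & adj (g x) (g k)].
  move=> ku kx; split; last by rewrite isom_adjC // adjC.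
    by rewrite -gu isom_adjC // adjC.
  by rewrite adjC stable.
have [ugp xgp gxgp] := adj_g p pu px.
have [ugq xgq gxgq] := adj_g q qu qx.
have [|//] := common2_all m2 gpq xu' ugp ugq xgp xgq gxgp gxgq.
by rewrite -{1}gu => /gi e; rewrite e eqxx in ux.
Qed.

(** Three common neighbours [p], [q], [r] of [u] and [x] form with them the complete bipartite
    subgraphs to which the edge count applies. If [d <= 3] the bound is immediate. *)
Lemma degree_bound u x : u != x -> 3 <= m -> common_nbrs [:: u; x] != set0 ->
  d <= m.+1.
Proof.
move=> ux m3 /set0Pn[a]; rewrite mem_common2 => /andP[au ax].
case: (leqP d 3) => [d3 | d4]; first by apply: leq_trans d3 _; apply: ltnW.
have : 2 < #|common_nbrs [:: u; x]| by rewrite (cmnG ux au ax).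
case/card_gt2P=> [p [q [r [[]]]]].
rewrite !mem_common2 => /andP[pu px] /andP[qu qx] /andP[ru rx] [pq qr rp].
have [s su] := exists_nbr u (d4 : size [:: p; q; r] < d).
rewrite !inE !negb_or => /and3P[sp sq sr].
pose star := [:: p; q; r; s].
have ustar : uniq star.
  by rewrite -rev_uniq /= !inE !negb_or sp sq sr [r == q]eq_sym qr rp [q == p]eq_sym pq.
have ucn n : common_nbrs (take n star) != set0.
  apply/set0Pn; exists u; apply/common_nbrsP => y /mem_take.
  by rewrite !inE => /or4P[] /eqP ->; rewrite adjC.
(* By [card_common_nbrs], any [n] leaves of a star give the same number for [n] from 1 to 4; a fixed
   star with four leaves serves as reference. *)
pose c n := #|common_nbrs (take n star)|.
have c_size l : uniq l -> 0 < size l <= 4 -> common_nbrs l != set0 ->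
    #|common_nbrs l| = c (size l).
  move=> ul /andP[_ l4] nl; apply: card_common_nbrs => //; first exact: take_uniq.
  by rewrite size_takel.
have count := common_nbrs_count c_size.
have upqr : uniq [:: p; q; r] by rewrite /= !inE negb_or pq qr eq_sym rp.
have uux : uniq [:: u; x] by rewrite /= inE ux.
have c1 : c 1 = d by rewrite -(c_size [:: u]) //; apply/set0Pn; exists p; rewrite inE /= pu.
have c2 : c 2 = m.
  rewrite -(c_size [:: u; x]) ?(cmnG ux au ax) //.
  by apply/set0Pn; exists a; rewrite mem_common2 au.
have up : adj u p by rewrite adjC.
have uq : adj u q by rewrite adjC.
have ur : adj u r by rewrite adjC.
have xp : adj x p by rewrite adjC.
have xq : adj x q by rewrite adjC.
have xr : adj x r by rewrite adjC.
have c3 : c 3 = #|common_nbrs [:: p; q; r]|.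
  rewrite -(c_size [:: p; q; r]) //; apply/set0Pn; exists u.
  by rewrite inE /= up uq ur.
have E1 := count [:: u; x] [:: p] uux isT isT isT.
have E2 := count [:: p; q; r] [:: u] upqr isT isT isT.
have E3 := count [:: p; q; r] [:: u; x] upqr uux isT isT.
move: E1 E2 E3; rewrite /= c1 c2 => E1 E2 E3.
apply: (count_arith m3 (t := c 3) (s := c 4)).
- rewrite c3; apply/andP; split.
    apply/card_gt1P; exists u, x; split=> //.
      by rewrite inE /= up uq ur.
    by rewrite inE /= xp xq xr.
  rewrite -(cmnG pq up uq); apply/subset_leq_card/subsetP => y.
  by rewrite mem_common2 inE /= => /and4P[-> ->].
- by rewrite card_gt0; apply: (ucn 4).
- apply: E1 => i j; rewrite !inE => ij /eqP->.
  by case/orP: ij => /eqP ->.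
- apply: E2 => i j; rewrite !inE => ij /eqP->.
  by case/or3P: ij => /eqP ->.
- apply: E3 => i j; rewrite !inE => ij uxj.
  by case/orP: uxj => /eqP ->; case/or3P: ij => /eqP ->.
Qed.

End Counting.

(** The degree [d] is [m], [m + 1], or larger; each case has its own one-point extension, valid for
    lists of any length. *)
Lemma CH_of_square u x a b : u != x -> a != b ->
  adj a u -> adj a x -> adj b u -> adj b x -> forall k, seq_CH G k.
Proof.
move=> ux ab au ax bu bx k.
pose d := #|common_nbrs [:: u]|; pose m := #|common_nbrs [:: u; x]|.
have nz y z l : adj z y -> all (adj z) l -> common_nbrs (y :: l) != set0.
  by move=> zy zl; apply/set0Pn; exists z; rewrite inE /= zy.
have degG : regular_nbrs d.
  move=> y; have [g ig gu] := vertex_transitive u y.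
  apply: card_common_nbrs => //; last by apply: (nz _ a).
  by apply: (nz _ (g a)); rewrite -?gu ?isom_adjC.
have cmnG : regular_common_nbrs m.
  move=> y y' z yy' zy zy'; apply: card_common_nbrs => //.
  - by rewrite /= inE yy'.
  - by rewrite /= inE ux.
  - by apply: (nz _ z); rewrite //= zy'.
  - by apply: (nz _ a); rewrite //= ax.
have m2 : 1 < m.
  by apply/card_gt1P; exists a, b; rewrite !mem_common2 au ax bu bx.
have md : m <= d.
  by apply/subset_leq_card/subsetP => y; rewrite mem_common2 !inE /= andbT => /andP[].
have step : forall s v w, grown s -> v \notin s -> w \notin s ->
    forall u, u \in s -> adj v u -> twins_in s v w -> fixing_aut s v w.
  move=> s v w gs vs ws u' us vu tw.
  have [dm|dm] := leqP d m.
    by apply: (twin_step degG cmnG _ vs ws us) => //; apply/eqP; rewrite eqn_leq dm.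
  have [dm1|dm1] := leqP d m.+1.
    by apply: (antipode_step degG cmnG _ _ vs ws us) => //; apply/eqP; rewrite eqn_leq dm1.
  (* Here [d > m + 1], so [degree_bound] excludes [m >= 3], and the square gives [m >= 2]. *)
  have mE : m = 2.
    apply/eqP; rewrite eqn_leq m2 andbT leqNgt; apply/negP => m3.
    have n0 : common_nbrs [:: u; x] != set0 by apply: (nz _ a); rewrite //= ax.
    by have := degree_bound degG cmnG ux m3 n0; rewrite leqNgt dm1.
  rewrite mE in dm1.
  have dE := degree5 degG cmnG mE dm1 ux au ax.
  exact: (clebsch_step degG cmnG mE dE gs vs ws us).
apply: seq_CH_step => s v w _ gs vs ws hv tw.
case/orP: hv => [/nilP s0 | /hasP[u' us vu]]; last exact: (step s v w gs vs ws u').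
have [g ig gv] := vertex_transitive v w.
by exists g => //; rewrite s0.
Qed.

End FiveCH.

Lemma fiveCH_CH (G : sgraph) : k_CH 5 G -> has_girth G 4 -> CH G.
Proof.
move=> /k_CH_seq S [[c [_ cyc] c4] girth] k _; apply: seq_k_CH.
have noK3 (x y z : G) : adj x y -> adj y z -> adj x z -> False.
  move=> xy yz xz; suff : is_graph_cycle [:: x; y; z] by move=> /girth.
  have ne (a b : G) : adj a b -> a != b by apply: contraTneq => ->; rewrite adj_irr.
  split=> //; rewrite /ucycle /= xy yz [adj z x]adjC xz !inE negb_or.
  by rewrite (ne _ _ xy) (ne _ _ yz) (ne _ _ xz).
case: c cyc c4 => [|u [|a [|x [|b [|]]]]] //.
rewrite /ucycle /= !inE !negb_or !andbT => /andP[/and4P[ua ax xb bu]].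
case/and3P=> /and3P[_ ux _] /andP[_ ab] _ _.
by apply: (CH_of_square S noK3 ux ab); rewrite // adjC.
Qed.

(** * Hypercubes *)

Section Hypercube.
Variable n : nat.
Implicit Types (x y z u v w : {ffun 'I_n.+1 -> bool}) (i j a b : 'I_n.+1).

Definition flip i x := [ffun j => x j (+) (j == i)].

Definition cube_adj : rel {ffun 'I_n.+1 -> bool} :=
  fun x y => #|[pred j | x j != y j]| == 1.

Lemma cube_adj_sym : symmetric cube_adj.
Proof.
by move=> x y; congr (_ == _); apply: eq_card => j; rewrite !inE eq_sym.
Qed.

Lemma cube_adj_irr : irreflexive cube_adj.
Proof.
by move=> x; rewrite /cube_adj eq_card0 // => j; rewrite !inE eqxx.
Qed.

Lemma cube_gt0 : 0 < #|{: {ffun 'I_n.+1 -> bool}}|.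
Proof. by rewrite card_ffun card_bool expn_gt0. Qed.

(** The dimension is [n + 1]. *)
Definition hypercube := SGraph cube_adj_sym cube_adj_irr cube_gt0.

Lemma cube_adjP x y : reflect (exists i, y = flip i x) (cube_adj x y).
Proof.
rewrite /cube_adj; apply: (iffP card1P) => -[i E]; exists i.
  apply/ffunP => j; rewrite ffunE; have := E j; rewrite !inE => <-.
  by case: (x j); case: (y j).
by move=> j; rewrite E !inE ffunE; case: (x j); case: (j == i).
Qed.

Lemma flip_adj i x : cube_adj x (flip i x).
Proof. by apply/cube_adjP; exists i. Qed.

Lemma flipC i j x : flip i (flip j x) = flip j (flip i x).
Proof. by apply/ffunP => k; rewrite !ffunE addbAC. Qed.

Lemma involutive_isom (g : hypercube -> hypercube) : involutive g ->
  (forall i x, cube_adj (g x) (g (flip i x))) -> is_isom g.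
Proof.
move=> gK gf; split; first exact: inv_bij.
have half x y : cube_adj x y -> cube_adj (g x) (g y) by case/cube_adjP => i ->.
by move=> x y; apply/idP/idP; [rewrite -{2}[x]gK -{2}[y]gK|]; apply: half.
Qed.

Lemma cube_transitive v w : exists2 g : hypercube -> hypercube, is_isom g & g v = w.
Proof.
pose g x := [ffun j => x j (+) (v j (+) w j)] : {ffun 'I_n.+1 -> bool}.
exists g; last by apply/ffunP => j; rewrite ffunE addbA addbb.
apply: involutive_isom => [x | i x]; first by apply/ffunP => j; rewrite !ffunE addbK.
by apply/cube_adjP; exists i; apply/ffunP => j; rewrite !ffunE addbAC.
Qed.

(** The exchange of coordinates [a] and [b], conjugated by translation by [u] so that it fixes
    [u]. *)
Definition swap_at u a b x : {ffun 'I_n.+1 -> bool} :=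
  [ffun j => x (tperm a b j) (+) u (tperm a b j) (+) u j].

Lemma swap_at_isom u a b : is_isom (swap_at u a b : hypercube -> hypercube).
Proof.
apply: involutive_isom => [x | i x].
  by apply/ffunP => j; rewrite !ffunE tpermK addbK -addbA addbb addbF.
apply/cube_adjP; exists (tperm a b i); apply/ffunP => j; rewrite !ffunE.
rewrite -(inj_eq (@perm_inj _ (tperm a b)) j) tpermK.
by rewrite -!addbA; congr (_ (+) _); rewrite addbC !addbA.
Qed.

Lemma swap_at_fix u a b x : x a (+) u a = x b (+) u b -> swap_at u a b x = x.
Proof.
move=> E; apply/ffunP => j; rewrite ffunE.
case: tpermP => [->|->|_ _]; last by rewrite addbK.
  by rewrite -E addbK.
by rewrite E addbK.
Qed.

Lemma swap_at_flip u a b : swap_at u a b (flip a u) = flip b u.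
Proof.
apply/ffunP => j; rewrite !ffunE (canF_eq (tpermK a b)) tpermL.
by case: (u _); case: (u j); case: eqP.
Qed.

(** With [v] and [w] obtained from [u] by flipping [a] and [b], the exchange of these coordinates
    about [u] fixes each vertex that differs from [u] in both or in neither. The twin condition
    ensures this for every vertex of [s], all of which lie within distance 2 of [u]. *)
Lemma hypercube_4CH : seq_CH hypercube 4.
Proof.
apply: seq_CH_step => s v w s4 gs vs ws hv tw.
case/orP: hv => [/nilP-> | /hasP[u us vu]].
  by have [g ig gv] := cube_transitive v w; exists g.
have wu : adj w u by rewrite -tw.
rewrite adjC in vu; rewrite adjC in wu.
case/cube_adjP: vu => a va; case/cube_adjP: wu => b wb.
have [ab|ab] := eqVneq a b.
  by exists id; [apply: is_isom_id | rewrite va wb ab].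
exists (swap_at u a b); first exact: swap_at_isom.
split; last by rewrite va wb swap_at_flip.
move=> x xs; apply: swap_at_fix.
have one c : x = flip c u -> x a (+) u a = x b (+) u b.
  move=> xc; have ca : a != c by apply: contraNneq vs => ac; rewrite va ac -xc.
  have cb : b != c by apply: contraNneq ws => bc; rewrite wb bc -xc.
  by rewrite xc !ffunE (negPf ca) (negPf cb) !addbF !addbb.
(* If [x] is a neighbour of [v'] other than [u], it is also a neighbour of [w'], so it differs from
   [u] in exactly [a'] and [b']. *)
have two c a' b' (v' w' : hypercube) : v' = flip a' u -> w' = flip b' u -> a' != b' ->
    (adj v' x -> adj w' x) -> x = flip c v' -> x a' (+) u a' = x b' (+) u b'.
  move=> -> -> ab' H xc.
  have [ca|ca] := eqVneq c a'.
    by rewrite xc ca !ffunE eqxx [b' == a']eq_sym (negPf ab') !addbF addbK !addbb.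
  have /H/cube_adjP[k] : adj (flip a' u : hypercube) x by apply/cube_adjP; exists c.
  rewrite xc => /ffunP E; have := E b'; have := E a'; rewrite !ffunE !eqxx.
  rewrite [b' == a']eq_sym [a' == c]eq_sym (negPf ab') (negPf ca).
  have [<-|_] := eqVneq a' k.
    by rewrite [b' == a']eq_sym (negPf ab'); case: (u a'); case: (u b'); case: (b' == c).
  by case: (u a').
have far c e : x = flip c (flip e u) -> x a (+) u a = x b (+) u b.
  move=> xce.
  have [ea|ea] := eqVneq e a; first by apply: (two c a b v w) => //; rewrite ?tw // xce ea va.
  have [eb|eb] := eqVneq e b.
    by apply/esym; apply: (two c b a w v); rewrite 1?eq_sym ?tw // xce eb wb.
  rewrite flipC in xce.
  have [ca|ca] := eqVneq c a; first by apply: (two e a b v w) => //; rewrite ?tw // xce ca va.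
  have [cb|cb] := eqVneq c b.
    by apply/esym; apply: (two e b a w v); rewrite 1?eq_sym ?tw // xce cb wb.
  rewrite xce !ffunE ![a == _]eq_sym ![b == _]eq_sym.
  by rewrite (negPf ea) (negPf eb) (negPf ca) (negPf cb) !addbF !addbb.
have [z Hz] : exists z : hypercube, {in s, forall y, y = z \/ adj z y}.
  by apply: grown_star => //; rewrite s4 andbT; case: (s) us.
case: (Hz x xs) => [xz|]; case: (Hz u us) => [uz|].
- by rewrite xz uz !addbb.
- by rewrite adjC -xz => /cube_adjP[c]; apply: one.
- by rewrite -uz => /cube_adjP[c]; apply: one.
- by rewrite adjC => /cube_adjP[c ->] /cube_adjP[e]; apply: far.
Qed.

Lemma hypercube_connected : connected hypercube.
Proof.
move=> x y; have [k] := ubnP #|[pred j | x j != y j]|.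
elim: k x => // k IH x lk.
have [/card0_eq E | ] := eqVneq #|[pred j | x j != y j]| 0.
  rewrite (_ : x = y) ?connect0 //; apply/ffunP => j.
  by have := E j; rewrite !inE => /negbFE/eqP.
rewrite -lt0n => /card_gt0P[i xi]; rewrite !inE in xi.
apply: (connect_trans (connect1 (flip_adj i x : @adj hypercube _ _))).
apply: IH; rewrite -ltnS; apply: leq_trans lk; rewrite ltnS; apply: proper_card; apply/properP; split.
  apply/subsetP => j; rewrite !inE ffunE.
  by have [->|_] := eqVneq j i; rewrite ?addbF.
exists i; rewrite !inE ?ffunE // eqxx.
by move: xi; case: (x i); case: (y i).
Qed.

Lemma hypercube_noK3 (x y z : hypercube) : adj x y -> adj y z -> adj x z -> False.
Proof.
case/cube_adjP=> i -> /cube_adjP[j ->] /cube_adjP[k /ffunP E].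
have := E k; have := E j; have := E i; rewrite !ffunE !eqxx [j == i]eq_sym.
have [<-|ij] := eqVneq i j.
  by case: (x i); case: (x k); case: (i == k); case: (k == i).
have [<-|_] := eqVneq i k; last by case: (x i).
by rewrite [j == i]eq_sym (negPf ij) => _; case: (x j).
Qed.

End Hypercube.

(** * Girth and failure of 5-CH in dimension at least four *)

Section Large.
Variable n : nat.
Local Notation N := n.+4.

Definition vtx (l : seq nat) : hypercube n.+3 := [ffun j : 'I_N => val j \in l].

(** The Hamming distance of vertices supported on the first four coordinates; it reduces adjacency
    and equality to computation. *)
Definition mismatches (l l' : seq nat) :=
  count (fun k => (k \in l) != (k \in l')) (iota 0 4).

Lemma card_mismatch l l' : all (gtn 4) l -> all (gtn 4) l' ->
  #|[pred j | vtx l j != vtx l' j]| = mismatches l l'.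
Proof.
move=> l4 l4'; pose P k := (k \in l) != (k \in l').
have out k : k \in iota 4 n -> P k = false.
  rewrite mem_iota => /andP[k4 _].
  have no (t : seq nat) : all (gtn 4) t -> k \in t = false.
    by move=> t4; apply/negP => /(allP t4) /=; rewrite ltnNge k4.
  by rewrite /P !no.
have -> : mismatches l l' = count P (iota 0 (4 + n)).
  by rewrite iotaD count_cat (eq_in_count (a2 := pred0) out) count_pred0 addn0.
rewrite -val_enum_ord [RHS]count_map enumT cardE /enum_mem size_filter.
by apply: eq_count => j; rewrite !inE /= !ffunE.
Qed.

Lemma vtx_adj l l' : all (gtn 4) l -> all (gtn 4) l' ->
  cube_adj (vtx l) (vtx l') = (mismatches l l' == 1).
Proof. by move=> l4 l4'; rewrite /cube_adj card_mismatch. Qed.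

Lemma vtx_eq l l' : all (gtn 4) l -> all (gtn 4) l' ->
  (vtx l == vtx l') = (mismatches l l' == 0).
Proof.
move=> l4 l4'; rewrite -card_mismatch //; apply/eqP/eqP => [->|/card0_eq E].
  by apply: eq_card0 => j; rewrite !inE eqxx.
by apply/ffunP => j; have := E j; rewrite !inE => /negbFE/eqP.
Qed.

Lemma hypercube_girth : has_girth (hypercube n.+3) 4.
Proof.
split.
  exists [:: vtx [::]; vtx [:: 0]; vtx [:: 0; 1]; vtx [:: 1]] => //; split=> //.
  by rewrite /ucycle /= !inE !negb_or !vtx_adj // !vtx_eq.
move=> [|x [|y [|z [|]]]] //= [// _]; rewrite /ucycle /=.
by case/andP=> /and4P[xy yz zx _] _; case: (hypercube_noK3 xy yz); rewrite adjC.
Qed.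

(** Two induced paths share four vertices; their last vertices, with supports 1, 2 and 0, 1, 2, 3,
    are at distance 2 and 4 from the common end [vtx [::]]. *)
Lemma hypercube_not5CH : ~ k_CH 5 (hypercube n.+3).
Proof.
move=> /k_CH_seq H.
pose p := [:: vtx [:: 0; 1; 2]; vtx [:: 0; 1]; vtx [:: 0]; vtx [::]].
have gr l : all (gtn 4) l -> mismatches l [:: 0; 1; 2] == 1 ->
    [&& mismatches l [:: 0; 1] != 0, mismatches l [:: 0] != 0 & mismatches l [::] != 0] ->
    grown (vtx l :: p).
  move=> l4 m1 /and3P[m2 m3 m4]; rewrite /p /= !inE !negb_or !vtx_adj // !vtx_eq //.
  by rewrite m1 m2 m3 m4 (eqP m1).
have [||||g ig [gx _ _ _ g0]] := H (vtx [:: 1; 2] :: p) (vtx [:: 0; 1; 2; 3] :: p).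
- by [].
- exact: gr.
- exact/grown_uniq/gr.
- by rewrite /p /= !vtx_adj.
(* The image of this common neighbour would be adjacent to both ends of the second path. *)
have a1 : adj (vtx [:: 1]) (vtx [:: 1; 2]) by rewrite /= vtx_adj.
have a2 : adj (vtx [::]) (vtx [:: 1]) by rewrite /= vtx_adj.
move: a1 a2; have [_ ag] := ig; rewrite -ag gx -[adj (vtx [::]) _]ag g0.
move=> /cube_adjP[i Ei] /cube_adjP[k Ek]; move: Ei; rewrite Ek => /ffunP E.
(* Two flips would have to reach the three coordinates 0, 1 and 2. *)
have hit j : j < 3 -> val k = j \/ val i = j.
  move=> j3; have jN : j < N by apply: leq_trans j3 _.
  have := E (Ordinal jN); rewrite !ffunE /= !inE.
  have [<- _|_] := eqVneq (Ordinal jN) k; first by left.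
  have [<- _|_] := eqVneq (Ordinal jN) i; first by right.
  by case: j j3 {jN} => [|[|[|]]].
have := hit 0 isT; have := hit 1 isT; have := hit 2 isT.
by move=> [->|->] [] // -> [].
Qed.

End Large.

Theorem theorem1p6 :
  (forall G : sgraph, k_CH 5 G -> has_girth G 4 -> CH G) /\
  (exists F : nat -> sgraph,
      (forall i : nat,
          connected (F i) /\ k_CH 4 (F i) /\ has_girth (F i) 4 /\ ~ k_CH 5 (F i)) /\
      (forall i j : nat, i <> j -> ~ isomorphic (F i) (F j))).
Proof.
split; first exact: fiveCH_CH.
(* Dimension [i + 4] leaves room for the path whose ends are at distance 4; distinct dimensions give
   distinct orders. *)
exists (fun i => hypercube i.+3); split=> [i | i j ij [f [bf _]]].
  split; first exact: hypercube_connected.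
  split; first exact/seq_k_CH/hypercube_4CH.
  by split; [apply: hypercube_girth | apply: hypercube_not5CH].
apply: ij; have := bij_eq_card bf.
by rewrite !card_ffun !card_bool !card_ord => /eqP; rewrite eqn_exp2l // => /eqP[].
Qed.
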